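(* Let $\mu=\mu_{x_0}$ be a probability measure on $\mathbb R$ that is not a Dirac mass and satisfies $\int_1^\infty\log x\,d\mu(x)<\infty$, and let $t>0$. Define $v_t=v_{x_0,t}$, $\Gamma_t$, $\Lambda_t=\Lambda_{x_0,t}$, $H_{-t}=H_{x_0,-t}$ as in the context. Then: (1) $H_{-t}$ is continuous and injective on $\overline{\Gamma}_t$. (2) Define $f_t:\mathbb R\to\mathbb R$ by $f_t(u_0)=\mathrm{Re}[H_{-t}(u_0+iv_t(u_0))]$. At every $u_0$ with $v_t(u_0)>0$, $f_t$ is differentiable and $0<f_t'(u_0)<2$. (3) $f_t$ is continuous, strictly increasing, and maps $\mathbb R$ onto $\mathbb R$; in particular $f_t^{-1}$ exists. (4) With $\varphi_t(u)=2v_t(f_t^{-1}(u))$ for $u\in\mathbb R$, we have $\varphi_t(u)\to0$ as $|u|\to\infty$, and $H_{-t}$ maps the graph of $v_t$ onto the graph of $\varphi_t$. (5) $H_{-t}$ maps the region above the graph of $v_t$ onto the region above the graph of $\varphi_t$. (6) The set $\Omega_{x_0,t}=\big[H_{-t}(\Lambda_t^c)\big]^c$ equals $\{u+iv\in\mathbb C:|v|<\varphi_t(u)\}$.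
   Context: $G_\mu(z)=\int\frac{d\mu(x)}{z-x}$ is the Cauchy transform. For $u\in\mathbb R$, $v_{x_0,t}(u)=\inf\{v>0:\int\frac{d\mu(x)}{(u-x)^2+v^2}\le\frac1t\}$ (so it is the unique $v>0$ with $\int\frac{d\mu(x)}{(u-x)^2+v^2}=\frac1t$ if such exists, and $0$ otherwise). $\Gamma_t=\{u+iv:v>v_{x_0,t}(u)\}$, $\Lambda_{x_0,t}=\{u+iv:|v|<v_{x_0,t}(u)\}$ (the support of $\mu$ is contained in $\overline{\Lambda}_{x_0,t}$). $H_{x_0,-t}(z)=z-tG_\mu(z)$ for $z\notin\mathrm{supp}\,\mu$, extended by continuity where needed (e.g. to points $u+iv_{x_0,t}(u)$ on the real line). *)

(* Defs.v *)
From HB Require Import structures.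
From mathcomp Require Import all_boot all_order all_algebra.
From mathcomp Require Import all_classical all_reals all_analysis.
Set Implicit Arguments. Unset Strict Implicit. Unset Printing Implicit Defensive.
Import Order.TTheory GRing.Theory Num.Theory.
Import numFieldNormedType.Exports.
Local Open Scope classical_set_scope.
Local Open Scope ring_scope.

(* Complex numbers z = u + i v are represented as pairs (u, v) : R * R. *)

Section Defs.
Variables (R : realType) (mu : {measure set R -> \bar R}) (t : R).

Definition vt (u : R) : R :=
  inf [set v : R | 0 < v /\
        (\int[mu]_x (((u - x) ^+ 2 + v ^+ 2)^-1)%:E <= (t^-1)%:E)%E].

Definition Gammat : set (R * R) := [set p | vt p.1 < p.2].

Definition Lambdat : set (R * R) := [set p | `|p.2| < vt p.1].

(* Real and imaginary parts of the Cauchy transform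
   G(u+iv) = int dmu(x)/(u+iv-x) = int ((u-x) - i v)/((u-x)^2+v^2) dmu(x). *)
Definition ReG (p : R * R) : R :=
  Rintegral mu setT (fun x => (p.1 - x) / ((p.1 - x) ^+ 2 + p.2 ^+ 2)).
Definition ImG (p : R * R) : R :=
  - Rintegral mu setT (fun x => p.2 / ((p.1 - x) ^+ 2 + p.2 ^+ 2)).

Definition Hmt (p : R * R) : R * R := (p.1 - t * ReG p, p.2 - t * ImG p).

Definition ft (u0 : R) : R := (Hmt (u0, vt u0)).1.

End Defs.

(* Main.v *)
(** For two points [p <> q] on or above the graph of [v_t], AM-GM gives
    [|t int dmu(x) / ((p-x)(q-x))| <= t/2 (int |p-x|^-2 + int |q-x|^-2) <= 1],
    and the inequality is strict because equality in AM-GM can hold for at most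
    one real [x] while [mu] is not a Dirac mass.  By the resolvent identity,
    [t G = id - H] is a strict contraction of Euclidean distances there.  Hence
    [H] is injective and Lipschitz; on the graph, where [H = f + 2 i v_t], the
    contraction says that the slopes of [f] lie in [(0, 2)].  Continuing [H] by
    [(u, v) |-> (f u, 2 v)] below the graph keeps [id - H] nonexpansive, and two
    applications of the intermediate value theorem make the continuation
    surjective onto the upper half plane; this identifies the image of the
    region above the graph. *)
Require Import Defs.
From HB Require Import structures.
From mathcomp Require Import all_boot all_order all_algebra.
From mathcomp Require Import all_classical all_reals all_analysis.
From mathcomp Require Import measurable_realfun ring lra.
Set Implicit Arguments.
Unset Strict Implicit.
Unset Printing Implicit Defensive.
Import Order.TTheory GRing.Theory Num.Theory.
Import numFieldNormedType.Exports.
Local Open Scope classical_set_scope.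
Local Open Scope ring_scope.

(** * Expectations under a probability measure, and their strict positivity *)

Section Mean.
Context {R : realType} (mu : probability R R).
Local Notation L1 f := (mu.-integrable setT (EFin \o f)).
Local Notation E f := (Rintegral mu setT f).
Implicit Types f g : R -> R.

Lemma L1_measurable f : L1 f -> measurable_fun setT f.
Proof. by move=> /integrableP[/measurable_EFinP]. Qed.

Lemma L1_le f g : measurable_fun setT f -> L1 g ->
  (forall x, `|f x| <= g x) -> L1 f.
Proof.
move=> mf ig fg; apply: (le_integrable _ _ _ ig) => //.
  exact/measurable_EFinP.
move=> x _ /=; rewrite lee_fin (le_trans (fg x))//; exact: ler_norm.
Qed.

Lemma L1_cst k : L1 (fun=> k).
Proof. exact: finite_measure_integrable_cst. Qed.

Lemma L1D f g : L1 f -> L1 g -> L1 (fun x => f x + g x).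
Proof. by move=> fi gi; exact: (integrableD measurableT fi gi). Qed.

Lemma L1B f g : L1 f -> L1 g -> L1 (fun x => f x - g x).
Proof. by move=> fi gi; exact: (integrableB measurableT fi gi). Qed.

Lemma L1Zl k f : L1 f -> L1 (fun x => k * f x).
Proof. by move=> fi; exact: (integrableZl measurableT k fi). Qed.

Lemma mean_cst k : E (fun=> k) = k.
Proof. by rewrite Rintegral_cst//= probability_setT mulr1. Qed.

Lemma meanD f g : L1 f -> L1 g -> E (fun x => f x + g x) = E f + E g.
Proof. exact: RintegralD. Qed.

Lemma meanB f g : L1 f -> L1 g -> E (fun x => f x - g x) = E f - E g.
Proof. exact: RintegralB. Qed.

Lemma meanZl k f : L1 f -> E (fun x => k * f x) = k * E f.
Proof. by move=> fi; rewrite RintegralZl. Qed.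

Lemma mean_le f g : L1 f -> L1 g -> (forall x, f x <= g x) -> E f <= E g.
Proof. by move=> fi gi fg; exact: le_Rintegral. Qed.

Lemma mean_norm f : L1 f -> `|E f| <= E (fun x => `|f x|).
Proof. exact: le_normr_Rintegral. Qed.

Lemma L1_norm f : L1 f -> L1 (fun x => `|f x|).
Proof. exact: integrable_norm. Qed.

Lemma mean_fin f : L1 f -> (\int[mu]_x (f x)%:E = (E f)%:E)%E.
Proof. by move=> fi; rewrite /Rintegral fineK//; exact: integrable_fin_num. Qed.

Lemma mean_ae f g : measurable_fun setT f -> measurable_fun setT g ->
  {ae mu, forall x, f x = g x} -> E f = E g.
Proof.
move=> mf mg fg; rewrite /Rintegral; congr fine; apply: ae_eq_integral => //.
- exact/measurable_EFinP.
- exact/measurable_EFinP.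
- by apply: filterS fg => x -> .
Qed.

Lemma mean_eq0_ae g : L1 g -> (forall x, 0 <= g x) -> E g <= 0 ->
  {ae mu, forall x, g x = 0}.
Proof.
move=> gi g0 Eg.
have mg : measurable_fun setT (EFin \o g) by case/integrableP: gi.
have : (\int[mu]_x `|(EFin \o g) x| = 0)%E.
  under eq_integral do rewrite /= ger0_norm//.
  rewrite mean_fin//; congr EFin; apply/eqP; rewrite eq_le Eg/=.
  exact: Rintegral_ge0.
move/(ae_eq_integral_abs mu measurableT mg).
by apply: filterS => x /(_ I)[].
Qed.

(** The complement of [[set a]] is null, so [a] carries mass 1; by additivity a measurable set
    missing [a] then has mass 0, and one containing [a] has mass 1 through its complement. *)
Lemma dirac_of_ae a : {ae mu, forall x, x = a} ->
  forall A : set R, measurable A -> mu A = \d_a A.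
Proof.
move=> h A mA.
have mC B : measurable B -> (mu B + mu (~` B) = 1)%E.
  move=> mB; rewrite -(probability_setT mu) -(setUv B).
  by rewrite measureU ?setICr//; exact: measurableC.
have D1 : mu [set a] = 1%E.
  have <- := mC [set a] (measurable_set1 a).
  suff -> : mu (~` [set a]) = 0%E by rewrite adde0.
  case: h => N [mN N0 hN]; apply: (subset_measure0 _ mN) => //.
  exact: measurableC.
have D0 B : measurable B -> ~ B a -> mu B = 0%E.
  move=> mB Ba; apply/eqP; rewrite eq_le measure_ge0 andbT.
  have mu1 : (mu (B `|` [set a]) <= 1)%E.
    by apply: probability_le1; exact: measurableU.
  have : (mu B + mu [set a] <= 1)%E.
    by rewrite -measureU//; apply/seteqP; split => // x /= [] /[swap] ->.
  by rewrite D1 -leeBrDr// subee.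
rewrite diracE; have [/set_mem Aa|/negP] := boolP (a \in A); last first.
  by rewrite inE => Aa; exact: D0.
have <- := mC A mA; rewrite [X in (_ + X)%E]D0 ?adde0//; first exact: measurableC.
Qed.

Hypothesis Hnd :
  ~ (exists a : R, forall A : set R, measurable A -> mu A = \d_a A).

(** A nonnegative function of mean 0 vanishes almost everywhere. If its zeros within a set of full
    measure reduce to one point, [mu] would be the Dirac mass there. All strict inequalities below
    rest on this. *)
Lemma mean_gt0 g a (Q : set R) : L1 g -> (forall x, 0 <= g x) ->
  {ae mu, forall x, Q x} -> (forall x, Q x -> g x = 0 -> x = a) -> 0 < E g.
Proof.
move=> gi g0 aeQ ga; rewrite ltNge; apply/negP => /(mean_eq0_ae gi g0) h.
apply: Hnd; exists a; apply: dirac_of_ae.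
by apply: filterS2 aeQ h => x; exact: ga.
Qed.

End Mean.

(* Real part and minus the imaginary part of [1 / (p - x)], and its squared
   modulus; all of them are [0] at the pole [p = (x, 0)]. *)
Definition rker {R : realType} (p : R * R) (x : R) : R :=
  (p.1 - x) / ((p.1 - x) ^+ 2 + p.2 ^+ 2).
Definition iker {R : realType} (p : R * R) (x : R) : R :=
  p.2 / ((p.1 - x) ^+ 2 + p.2 ^+ 2).
Definition kern {R : realType} (p : R * R) (x : R) : R :=
  ((p.1 - x) ^+ 2 + p.2 ^+ 2)^-1.

(** * Pointwise algebra of the resolvent kernel *)

Section Kernel.
Context {R : realType}.
Implicit Types (p q : R * R) (x : R).

Lemma kern_ge0 p x : 0 <= kern p x.
Proof. by rewrite invr_ge0 addr_ge0// sqr_ge0. Qed.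

Lemma kern_neq0 p x :
  kern p x != 0 -> (p.1 - x) ^+ 2 + p.2 ^+ 2 != 0.
Proof. by rewrite invr_eq0. Qed.

Lemma kern_gt0 p x : p.2 != 0 -> 0 < kern p x.
Proof.
by move=> p0; rewrite invr_gt0 ltr_wpDl ?sqr_ge0// exprn_even_gt0.
Qed.

Lemma rker2Diker2 p x : rker p x ^+ 2 + iker p x ^+ 2 = kern p x.
Proof.
have [k0|k0] := eqVneq (kern p x) 0.
  by rewrite /rker /iker -/(kern p x) k0 !mulr0 expr0n addr0.
by have := kern_neq0 k0; rewrite /kern /rker /iker => d0; field.
Qed.

(** Real part of [1/(p-x) - 1/(q-x) = (q-p) / ((p-x)(q-x))]. The hypotheses keep [x] off both poles,
    where the convention [0^-1 = 0] would break the identity. *)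
Lemma resolvent_re p q x : kern p x != 0 -> kern q x != 0 ->
  rker p x - rker q x =
    (q.1 - p.1) * (rker p x * rker q x - iker p x * iker q x)
    + (q.2 - p.2) * (rker p x * iker q x + iker p x * rker q x).
Proof.
by move=> /kern_neq0 p0 /kern_neq0 q0; rewrite /rker /iker; field; apply/andP.
Qed.

Lemma resolvent_im p q x : kern p x != 0 -> kern q x != 0 ->
  iker p x - iker q x =
    (q.1 - p.1) * (rker p x * iker q x + iker p x * rker q x)
    - (q.2 - p.2) * (rker p x * rker q x - iker p x * iker q x).
Proof.
by move=> /kern_neq0 p0 /kern_neq0 q0; rewrite /rker /iker; field; apply/andP.
Qed.

(* With [a = 1/(p-x)], [b = 1/(q-x)] and [w = c + is] on the unit circle, this
   is [|a|^2 + |b|^2 - 2 Re (w a b) = |conj a - w b|^2]. *)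
Lemma kern_slack p q x c s : c ^+ 2 + s ^+ 2 = 1 ->
  kern p x + kern q x
  - 2 * (c * (rker p x * rker q x - iker p x * iker q x)
         + s * (rker p x * iker q x + iker p x * rker q x)) =
  (rker p x - (c * rker q x + s * iker q x)) ^+ 2
  + (iker p x - (s * rker q x - c * iker q x)) ^+ 2.
Proof.
move=> cs; apply/eqP; rewrite -subr_eq0 -!rker2Diker2; apply/eqP.
transitivity ((1 - (c ^+ 2 + s ^+ 2)) * (rker q x ^+ 2 + iker q x ^+ 2)).
  ring.
by rewrite cs subrr mul0r.
Qed.

End Kernel.

(** * The averaged resolvent identity and strict contraction of [t G] *)

Section Secant.
Context {R : realType} (mu : probability R R).
Local Notation L1 f := (mu.-integrable setT (EFin \o f)).
Local Notation E f := (Rintegral mu setT f).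
Implicit Types (p q : R * R).

Lemma measurable_kern p : measurable_fun setT (kern p).
Proof.
have -> : kern p = fun x => ((p.1 - x) ^+ 2 + p.2 ^+ 2) `^ (-1).
  by apply/funext => x; rewrite powR_inv1// addr_ge0// sqr_ge0.
apply: (measurableT_comp (measurable_powR (-1))).
by apply: measurable_funD => //; apply: measurable_funX; exact: measurable_funB.
Qed.

Lemma measurable_rker p : measurable_fun setT (rker p).
Proof.
by apply: measurable_funM; [exact: measurable_funB|exact: measurable_kern].
Qed.

Lemma measurable_iker p : measurable_fun setT (iker p).
Proof. by apply: measurable_funM; [|exact: measurable_kern]. Qed.

(** From [|a| <= 1 + a^2]. Being free of [p.2], the bound also yields integrability at real points,
    where the kernels may be unbounded. *)
Lemma rker_le p x : `|rker p x| <= 1 + kern p x.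
Proof.
rewrite -rker2Diker2 real_normrEsign ?num_real//; case: (_ < _); rewrite /=;
  nra.
Qed.

Lemma iker_le p x : `|iker p x| <= 1 + kern p x.
Proof.
rewrite -rker2Diker2 real_normrEsign ?num_real//; case: (_ < _); rewrite /=;
  nra.
Qed.

Lemma L1_rker p : L1 (kern p) -> L1 (rker p).
Proof.
move=> ip; apply: (@L1_le _ _ _ (fun x => 1 + kern p x)).
- exact: measurable_rker.
- by apply: L1D ip; exact: L1_cst.
- exact: rker_le.
Qed.

Lemma L1_iker p : L1 (kern p) -> L1 (iker p).
Proof.
move=> ip; apply: (@L1_le _ _ _ (fun x => 1 + kern p x)).
- exact: measurable_iker.
- by apply: L1D ip; exact: L1_cst.
- exact: iker_le.
Qed.

(* Real part and minus the imaginary part of [1 / ((p - x) (q - x))]. *)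
Definition rker2 p q x := rker p x * rker q x - iker p x * iker q x.
Definition iker2 p q x := rker p x * iker q x + iker p x * rker q x.

Lemma measurable_rker2 p q : measurable_fun setT (rker2 p q).
Proof.
by apply: measurable_funB; apply: measurable_funM;
  [exact: measurable_rker|exact: measurable_rker
  |exact: measurable_iker|exact: measurable_iker].
Qed.

Lemma measurable_iker2 p q : measurable_fun setT (iker2 p q).
Proof.
by apply: measurable_funD; apply: measurable_funM;
  [exact: measurable_rker|exact: measurable_iker
  |exact: measurable_iker|exact: measurable_rker].
Qed.

Lemma L1_rker2 p q : L1 (kern p) -> L1 (kern q) -> L1 (rker2 p q).
Proof.
move=> ip iq; apply: (L1_le (measurable_rker2 p q) (L1D ip iq)) => x.
rewrite -!rker2Diker2 ler_norml /rker2.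
move: (rker p x) (iker p x) (rker q x) (iker q x) => a b c d.
have := sqr_ge0 (a + c); have := sqr_ge0 (a - c).
have := sqr_ge0 (b + d); have := sqr_ge0 (b - d).
have := sqr_ge0 a; have := sqr_ge0 b; have := sqr_ge0 c; have := sqr_ge0 d.
by move=> *; apply/andP; split; nra.
Qed.

Lemma L1_iker2 p q : L1 (kern p) -> L1 (kern q) -> L1 (iker2 p q).
Proof.
move=> ip iq; apply: (L1_le (measurable_iker2 p q) (L1D ip iq)) => x.
rewrite -!rker2Diker2 ler_norml /iker2.
move: (rker p x) (iker p x) (rker q x) (iker q x) => a b c d.
have := sqr_ge0 (a + d); have := sqr_ge0 (a - d).
have := sqr_ge0 (b + c); have := sqr_ge0 (b - c).
have := sqr_ge0 a; have := sqr_ge0 b; have := sqr_ge0 c; have := sqr_ge0 d.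
by move=> *; apply/andP; split; nra.
Qed.

Lemma ReG_sub p q : L1 (kern p) -> L1 (kern q) ->
  {ae mu, forall x, kern p x != 0} -> {ae mu, forall x, kern q x != 0} ->
  ReG mu p - ReG mu q = (q.1 - p.1) * E (rker2 p q) + (q.2 - p.2) * E (iker2 p q).
Proof.
move=> ip iq np nq.
have i1 := L1Zl (q.1 - p.1) (L1_rker2 ip iq).
have i2 := L1Zl (q.2 - p.2) (L1_iker2 ip iq).
rewrite -!meanZl; [|exact: L1_iker2|exact: L1_rker2].
rewrite -meanD// -meanB; [|exact: L1_rker|exact: L1_rker].
apply: mean_ae.
- by apply: measurable_funB; exact: measurable_rker.
- by apply: measurable_funD; [exact: L1_measurable i1|exact: L1_measurable i2].
- by apply: filterS2 np nq => x; exact: resolvent_re.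
Qed.

Lemma ImG_sub p q : L1 (kern p) -> L1 (kern q) ->
  {ae mu, forall x, kern p x != 0} -> {ae mu, forall x, kern q x != 0} ->
  ImG mu q - ImG mu p = (q.1 - p.1) * E (iker2 p q) - (q.2 - p.2) * E (rker2 p q).
Proof.
move=> ip iq np nq.
have i1 := L1Zl (q.1 - p.1) (L1_iker2 ip iq).
have i2 := L1Zl (q.2 - p.2) (L1_rker2 ip iq).
rewrite /ImG opprK addrC -!meanZl; [|exact: L1_rker2|exact: L1_iker2].
rewrite -!meanB//; [|exact: L1_iker|exact: L1_iker].
apply: mean_ae.
- by apply: measurable_funB; exact: measurable_iker.
- by apply: measurable_funB; [exact: L1_measurable i1|exact: L1_measurable i2].
- by apply: filterS2 np nq => x; exact: resolvent_im.
Qed.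

Hypothesis Hnd :
  ~ (exists a : R, forall A : set R, measurable A -> mu A = \d_a A).

(** The difference of the two sides is the mean of the square in [kern_slack]. That square can
    vanish for at most one [x] off the poles, so its mean is positive for a measure that is not
    Dirac. *)
Lemma mean_slack_gt0 p q c s : c ^+ 2 + s ^+ 2 = 1 ->
  L1 (kern p) -> L1 (kern q) ->
  {ae mu, forall x, kern p x != 0} -> {ae mu, forall x, kern q x != 0} ->
  0 <= p.2 -> 0 <= q.2 -> ~ (p = q /\ p.2 = 0) ->
  2 * (c * E (rker2 p q) + s * E (iker2 p q)) < E (kern p) + E (kern q).
Proof.
move=> cs ip iq np nq p0 q0 pq.
have i1 := L1Zl c (L1_rker2 ip iq); have i2 := L1Zl s (L1_iker2 ip iq).
have i3 := L1Zl 2 (L1D i1 i2); have i4 := L1D ip iq.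
rewrite -subr_gt0 -!meanZl; [|exact: L1_iker2|exact: L1_rker2].
rewrite -[X in 2 * X]meanD// -meanZl; last exact: L1D.
rewrite -[X in X - _]meanD// -meanB//.
(* The only possible zero, obtained by solving the real part of [p - x = w conj(q - x)],
   [w = c + is], for [x]. *)
apply: (@mean_gt0 _ mu Hnd _ ((p.1 - c * q.1 - s * q.2) / (1 - c))
  [set x | kern p x != 0 /\ kern q x != 0]).
- exact: L1B.
- by move=> x; rewrite kern_slack// addr_ge0// sqr_ge0.
- by apply: filterS2 np nq.
move=> x [/= px qx]; rewrite kern_slack// => /eqP.
rewrite paddr_eq0 ?sqr_ge0// !sqrf_eq0 !subr_eq0 => /andP[/eqP e1 /eqP e2].
have ekpq : kern p x = kern q x.
  rewrite -rker2Diker2 e1 e2 -[RHS]rker2Diker2.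
  by rewrite -[RHS]mul1r -cs; ring.
(* Equal moduli let the common factor [kern] cancel, turning [conj a = w b] into
   [p - x = w conj(q - x)]. *)
have {}e1 : p.1 - x = c * (q.1 - x) + s * q.2.
  by apply: (mulIf qx); rewrite -[in LHS]ekpq
    -/(rker p x) e1 /rker /iker -/(kern q x); ring.
have {}e2 : p.2 = s * (q.1 - x) - c * q.2.
  by apply: (mulIf qx); rewrite -[in LHS]ekpq
    -/(iker p x) e2 /rker /iker -/(kern q x); ring.
(* For [w = 1] the relation reads [p = conj q]; both points lie in the closed upper half plane, so
   they are equal and real, the excluded case. *)
have [c1|c1] := eqVneq c 1.
  have s0 : s = 0.
    by apply/eqP; rewrite -sqrf_eq0; apply/eqP; move: cs; rewrite c1; lra.
  move: e1 e2; rewrite c1 s0 => e1 e2; exfalso; apply: pq.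
  have z : p.2 = 0 by lra.
  split => //; rewrite [p]surjective_pairing [q]surjective_pairing; congr (_, _); lra.
have c1' : 1 - c != 0 by rewrite subr_eq0 eq_sym.
by apply: (mulIf c1'); rewrite divfK//; lra.
Qed.

Variable t : R.
Hypothesis t0 : 0 < t.

(** The properties of points on or above the graph of [v_t] that the contraction uses. The last one
    matters for [p.2 = 0]: it says that [p.1] is not an atom of [mu]. *)
Definition adm p := [/\ 0 <= p.2, L1 (kern p), E (kern p) <= t^-1 &
  {ae mu, forall x, kern p x != 0}].

(** Choosing the unit vector [(c, s)] along the pair of means turns [mean_slack_gt0] into a bound on
    their modulus [n], namely [2 n < 2 / t]. The case [p = q] off the real line is kept because the
    derivative of [f] needs it. *)
Lemma secant_lt1 p q : adm p -> adm q -> ~ (p = q /\ p.2 = 0) ->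
  (t * E (rker2 p q)) ^+ 2 + (t * E (iker2 p q)) ^+ 2 < 1.
Proof.
move=> [p0 ip Ip np] [q0 iq Iq nq] pq.
set A := E (rker2 p q); set B := E (iker2 p q).
pose n : R := Num.sqrt (A ^+ 2 + B ^+ 2).
have n2 : n ^+ 2 = A ^+ 2 + B ^+ 2 by rewrite sqr_sqrtr// addr_ge0// sqr_ge0.
have n0 : 0 <= n by exact: sqrtr_ge0.
have -> : (t * A) ^+ 2 + (t * B) ^+ 2 = (t * n) ^+ 2 by rewrite !exprMn n2; ring.
have [->|nn0] := eqVneq n 0; first by rewrite mulr0 expr0n.
have cs : (A / n) ^+ 2 + (B / n) ^+ 2 = 1.
  by rewrite !expr_div_n -mulrDl -n2 divff// sqrf_eq0.
have := mean_slack_gt0 cs ip iq np nq p0 q0 pq; rewrite -/A -/B.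
have -> : A / n * A + B / n * B = n.
  by apply: (mulIf nn0); rewrite -[RHS]expr2 n2; field.
move=> h; have {}h : n < t^-1 by lra.
have tn0 : 0 <= t * n by rewrite mulr_ge0// ltW.
have tn1 : t * n < 1 by rewrite -ltr_pdivlMl// mulr1.
by rewrite expr_lt1.
Qed.

Lemma tG_contract p q : adm p -> adm q -> p <> q ->
  (t * ReG mu p - t * ReG mu q) ^+ 2 + (t * ImG mu p - t * ImG mu q) ^+ 2
  < (p.1 - q.1) ^+ 2 + (p.2 - q.2) ^+ 2.
Proof.
move=> ap aq pq; have [_ ip _ np] := ap; have [_ iq _ nq] := aq.
have := secant_lt1 ap aq (fun h => pq h.1).
rewrite -!mulrBr -(opprB (ImG mu q)) ReG_sub// ImG_sub//.
set A := E _; set B := E _ => h.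
have d0 : 0 < (p.1 - q.1) ^+ 2 + (p.2 - q.2) ^+ 2.
  rewrite lt_neqAle addr_ge0 ?sqr_ge0// andbT eq_sym paddr_eq0 ?sqr_ge0//.
  rewrite !sqrf_eq0 !subr_eq0; apply/negP => /andP[/eqP e1 /eqP e2]; apply: pq.
  by rewrite [p]surjective_pairing [q]surjective_pairing e1 e2.
move: h; rewrite -(ltr_pM2r d0) mul1r; congr (_ < _); ring.
Qed.

End Secant.

(** * The boundary function [v_t]: defining equation and continuity *)

Section Boundary.
Context {R : realType} (mu : probability R R) (t : R).
Local Notation L1 f := (mu.-integrable setT (EFin \o f)).
Local Notation E f := (Rintegral mu setT f).
Local Notation vt := (vt mu t).
Implicit Types (p q : R * R) (u v w x : R).

Lemma kern_le_sqr p x : p.2 != 0 -> kern p x <= p.2 ^- 2.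
Proof.
move=> p0; rewrite lef_pV2 ?posrE ?exprn_even_gt0//; last first.
  by rewrite ltr_wpDl ?sqr_ge0// exprn_even_gt0.
by rewrite lerDr sqr_ge0.
Qed.

Lemma rker_le_inv p x : 0 < p.2 -> `|rker p x| <= p.2^-1.
Proof.
move=> p0; rewrite /rker normrM (ger0_norm (kern_ge0 p x)).
have d0 : 0 < (p.1 - x) ^+ 2 + p.2 ^+ 2.
  by rewrite ltr_wpDl ?sqr_ge0// exprn_gt0.
rewrite ler_pdivrMr// ler_pdivlMl//.
have := sqr_ge0 (p.2 - `|p.1 - x|); rewrite -(real_normK (num_real (p.1 - x))).
by have := normr_ge0 (p.1 - x); nra.
Qed.

Lemma iker_le_inv p x : 0 < p.2 -> `|iker p x| <= p.2^-1.
Proof.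
move=> p0; rewrite /iker normrM (ger0_norm (kern_ge0 p x)) gtr0_norm//.
have d0 : 0 < (p.1 - x) ^+ 2 + p.2 ^+ 2.
  by rewrite ltr_wpDl ?sqr_ge0// exprn_gt0.
rewrite ler_pdivrMr// ler_pdivlMl//.
by have := sqr_ge0 (p.1 - x); nra.
Qed.

Lemma L1_kern p : p.2 != 0 -> L1 (kern p).
Proof.
move=> p0; apply: (@L1_le _ _ _ (fun=> p.2 ^- 2)).
- exact: measurable_kern.
- exact: L1_cst.
- by move=> x; rewrite ger0_norm ?kern_ge0// kern_le_sqr.
Qed.

Lemma kern_le u v w x : 0 < v -> v <= w -> kern (u, w) x <= kern (u, v) x.
Proof.
move=> v0 vw; have w0 := lt_le_trans v0 vw.
rewrite lef_pV2 ?posrE/= ?ltr_wpDl ?sqr_ge0 ?exprn_gt0//.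
by rewrite lerD2l ler_pXn2r// nnegrE ltW.
Qed.

Lemma kern_lt u v w x : 0 < v -> v < w -> kern (u, w) x < kern (u, v) x.
Proof.
move=> v0 vw; have w0 := lt_trans v0 vw.
have d0 (y : R) : 0 < y -> 0 < (u - x) ^+ 2 + y ^+ 2.
  by move=> y0; rewrite ltr_wpDl ?sqr_ge0 ?exprn_gt0.
rewrite ltf_pV2 ?posrE ?d0//= ltrD2l.
by rewrite ltr_pXn2r ?nnegrE ?ltW.
Qed.

(** After clearing denominators this is [v^2 (u-x)^2 <= w^2 (u-x)^2]. It limits the growth of the
    mean when the height is lowered by a fixed factor. *)
Lemma kern_scale u v w x : 0 < v -> v <= w ->
  kern (u, v) x <= (w / v) ^+ 2 * kern (u, w) x.
Proof.
move=> v0 vw; have w0 := lt_le_trans v0 vw.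
have d0 (y : R) : 0 < y -> 0 < (u - x) ^+ 2 + y ^+ 2.
  by move=> y0; rewrite ltr_wpDl ?sqr_ge0 ?exprn_gt0.
rewrite /kern /= expr_div_n mulrAC ler_pdivlMr ?exprn_gt0//.
rewrite ler_pdivlMr ?d0// -mulrA ler_pdivrMl ?d0//.
have : v ^+ 2 <= w ^+ 2 by rewrite ler_pXn2r// nnegrE ltW.
move=> vw2; rewrite -subr_ge0.
rewrite (_ : _ - _ = (u - x) ^+ 2 * (w ^+ 2 - v ^+ 2)); last by ring.
by rewrite mulr_ge0 ?sqr_ge0 ?subr_ge0.
Qed.

Lemma kern_lipschitz u u' v x : 0 < v ->
  `|kern (u, v) x - kern (u', v) x| <= 2 * v ^- 3 * `|u - u'|.
Proof.
move=> v0; have v0' : v != 0 by rewrite gt_eqF.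
have d0 (y : R) : (y - x) ^+ 2 + v ^+ 2 != 0.
  by rewrite gt_eqF// ltr_wpDl ?sqr_ge0// exprn_gt0.
have -> : kern (u, v) x - kern (u', v) x =
    - (u - u') * (rker (u, v) x * kern (u', v) x
                  + rker (u', v) x * kern (u, v) x).
  by rewrite /kern /rker /=; field; rewrite !d0.
rewrite normrM normrN mulrC ler_wpM2r//.
have -> : 2 * v ^- 3 = v^-1 * v ^- 2 + v^-1 * v ^- 2 by field.
have k0 (y : R) : `|kern (y, v) x| <= v ^- 2.
  by rewrite ger0_norm ?kern_ge0//; apply: (@kern_le_sqr (y, v)).
have r0 (y : R) : `|rker (y, v) x| <= v^-1 by apply: (@rker_le_inv (y, v)).
apply: (le_trans (ler_normD _ _)).
rewrite (normrM (rker (u, v) x)) (normrM (rker (u', v) x)).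
by apply: lerD; apply: ler_pM; rewrite ?normr_ge0 ?r0 ?k0.
Qed.

Lemma mean_kern_lipschitz u u' v : 0 < v ->
  `|E (kern (u, v)) - E (kern (u', v))| <= 2 * v ^- 3 * `|u - u'|.
Proof.
move=> v0; have v0' : v != 0 by rewrite gt_eqF.
have i1 : L1 (kern (u, v)) by exact: L1_kern.
have i2 : L1 (kern (u', v)) by exact: L1_kern.
rewrite -meanB//; apply: (le_trans (mean_norm (L1B i1 i2))).
rewrite -[leRHS](mean_cst mu); apply: mean_le.
- exact: L1_norm (L1B i1 i2).
- exact: L1_cst.
- by move=> x; exact: kern_lipschitz.
Qed.

Hypothesis t0 : 0 < t.

Lemma vtE u : vt u = inf [set v | 0 < v /\ E (kern (u, v)) <= t^-1].
Proof.
rewrite /Defs.vt; congr inf; apply/seteqP.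
by split => v /= [v0]; rewrite -[X in (X <= _)%E]/(\int[mu]_x (kern (u, v) x)%:E)%E
  mean_fin ?lee_fin// ; apply: L1_kern => /=; rewrite gt_eqF.
Qed.

Lemma vt_set_neq0 u : [set v | 0 < v /\ E (kern (u, v)) <= t^-1] !=set0.
Proof.
have t1 : 0 < t + 1 by rewrite addr_gt0.
(* At height [t + 1] the kernel is at most [(t + 1)^-2], and [t <= (t + 1)^2]. *)
exists (t + 1); split => //.
rewrite -[leRHS](mean_cst mu); apply: mean_le; [|exact: L1_cst|].
  by apply: L1_kern; rewrite gt_eqF.
move=> x; apply: le_trans (kern_le_sqr _ _) _ => /=; first by rewrite gt_eqF.
have tt : t <= (t + 1) ^+ 2 by have := sqr_ge0 t; have := t0; nra.
by rewrite lef_pV2 ?posrE ?exprn_gt0.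
Qed.

Lemma vt_set_lbound u :
  lbound [set v | 0 < v /\ E (kern (u, v)) <= t^-1] 0.
Proof. by move=> v /= [/ltW]. Qed.

Lemma vt_ge0 u : 0 <= vt u.
Proof.
by rewrite vtE; apply: lb_le_inf; [exact: vt_set_neq0|exact: vt_set_lbound].
Qed.

Lemma vt_le u v : 0 < v -> E (kern (u, v)) <= t^-1 -> vt u <= v.
Proof.
move=> v0 Ev; rewrite vtE; apply: ge_inf => //.
by exists 0; exact: vt_set_lbound.
Qed.

Lemma mean_kern_le u v : vt u < v -> E (kern (u, v)) <= t^-1.
Proof.
rewrite vtE => /inf_lt-/(_ (vt_set_neq0 u))[w /= [w0 Ew] wv].
apply: le_trans Ew; apply: mean_le => [||x].
- by apply: L1_kern; rewrite gt_eqF// (lt_trans w0).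
- by apply: L1_kern; rewrite gt_eqF.
- exact/kern_le/ltW.
Qed.

Lemma mean_kern_gt u v : 0 < v -> v < vt u -> t^-1 < E (kern (u, v)).
Proof.
by move=> v0; apply: contraTlt => Ev; rewrite -leNgt vt_le.
Qed.

(** [kern (u, 0)] vanishes only at its pole [u]. A mass [m] at [u] would give
    [m / w^2 <= E (kern (u, w)) <= 1/t] for every [w > 0], forcing [m = 0]. *)
Lemma vt_no_atom u : vt u = 0 -> {ae mu, forall x, kern (u, 0) x != 0}.
Proof.
move=> vu; exists [set u]; split => //; last first.
  move=> x /= /negP; rewrite negbK invr_eq0 expr0n addr0 sqrf_eq0 subr_eq0.
  by move=> /eqP.
pose m := fine (mu [set u]).
have mE : mu [set u] = m%:E by rewrite fineK// fin_num_measure.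
have m0 : 0 <= m by rewrite -lee_fin -mE measure_ge0.
have mi : L1 \1_[set u] by apply: integrable_indic => //; rewrite mE ltry.
have mw w : 0 < w -> w ^- 2 * m <= t^-1.
  move=> w0; apply: le_trans (@mean_kern_le u w _); last by rewrite vu.
  have -> : m = E \1_[set u].
    by rewrite /m /Rintegral integral_indic// setIT.
  rewrite -meanZl//; apply: mean_le => [||x].
  - exact: L1Zl.
  - by apply: L1_kern; rewrite gt_eqF.
  rewrite indicE; case: (boolP (x \in [set u])) => [/set_mem ->|_].
    by rewrite mulr1 /kern /= subrr expr0n add0r.
  by rewrite mulr0 kern_ge0.
rewrite mE; congr EFin; apply/eqP; rewrite eq_le m0 andbT leNgt.
apply/negP => m1.
(* Then [w^2 <= w <= m t / 2 < m t], contradicting [m t <= w^2]. *)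
pose w := Num.min 1 (m * t / 2).
have w0 : 0 < w by rewrite lt_min ltr01 divr_gt0// mulr_gt0.
have := mw _ w0; rewrite ler_pdivrMl ?exprn_gt0// => h.
have w1 : w <= 1 by rewrite ge_min lexx.
have w2 : w <= m * t / 2 by rewrite ge_min lexx orbT.
have := ler_wpM2r (ltW t0) h; rewrite divfK ?gt_eqF// => h'.
by have := mulr_gt0 m1 t0; nra.
Qed.

(* Fatou's lemma along [v + 1 / (n + 1)]; the factor [kern p * (kern p)^-1]
   removes a possible pole of the limit. *)
Lemma vt_fatou u v : vt u <= v ->
  L1 (kern (u, v)) /\ E (kern (u, v)) <= t^-1.
Proof.
move=> uv; set p := (u, v).
pose w n := v + @harmonic R n.
have w0 n : vt u < w n by rewrite (le_lt_trans uv)// ltrDl harmonic_gt0.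
have wp n : 0 < w n := le_lt_trans (vt_ge0 u) (w0 n).
pose g n x := kern p x * (kern p x)^-1 * kern (u, w n) x.
have kw n : L1 (kern (u, w n)) by apply: L1_kern; rewrite (gt_eqF (wp n)).
have mg n : measurable_fun setT (EFin \o g n).
  apply/measurable_EFinP; apply: measurable_funM; last exact: measurable_kern.
  apply: measurable_funM; first exact: measurable_kern.
  rewrite (_ : (fun x => _) = fun x => (p.1 - x) ^+ 2 + p.2 ^+ 2).
    by apply: measurable_funD => //; apply: measurable_funX; exact: measurable_funB.
  by apply/funext => x; rewrite invrK.
have g0 n x : 0 <= g n x.
  by apply: mulr_ge0 (kern_ge0 _ _); apply: mulr_ge0; [|rewrite invr_ge0];
    exact: kern_ge0.
have gk n x : g n x <= kern (u, w n) x.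
  rewrite /g; have [->|k0] := eqVneq (kern p x) 0; first by rewrite !mul0r kern_ge0.
  by rewrite divff// mul1r.
have g1 x : (g n x)%:E @[n --> \oo] --> (kern p x)%:E.
  apply: cvg_EFin; first exact: nearW.
  rewrite /g; have [k0|k0] := eqVneq (kern p x) 0.
    by rewrite /= k0; under eq_fun do rewrite !mul0r; exact: cvg_cst.
  under eq_fun do rewrite divff// mul1r.
  have c : ((u - x) ^+ 2 + w n ^+ 2) @[n --> \oo] --> (u - x) ^+ 2 + v ^+ 2.
    apply: cvgD; first exact: cvg_cst.
    apply: (cvgM (f := w) (g := w)); rewrite -[v in _ --> v]addr0;
      (apply: cvgD; [exact: cvg_cst|exact: cvg_harmonic]).
  exact: (cvgV (kern_neq0 k0) c).
have lim x : limn_einf (fun n => (g n x)%:E) = (kern p x)%:E.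
  by have [-> _] := cvg_limn_einf_sup (g1 x).
have F : (\int[mu]_x (kern p x)%:E <= (t^-1)%:E)%E.
  have := @fatou _ _ _ mu setT measurableT (fun n => EFin \o g n) mg
    (fun n x _ => g0 n x).
  under eq_integral => x _ do rewrite lim.
  move=> /le_trans; apply; rewrite limn_einf_lim; apply: lime_le.
    exact: is_cvg_einfs.
  apply: nearW => n.
  apply: (@le_trans _ _ (\int[mu]_x (g n x)%:E)%E).
    by apply: ereal_inf_lbound; exists n => /=.
  apply: (@le_trans _ _ (\int[mu]_x (kern (u, w n) x)%:E)%E).
    apply: ge0_le_integral => //.
    - by move=> x _; rewrite lee_fin g0.
    - exact: mg.
    - by apply/measurable_EFinP; exact: measurable_kern.
    - by move=> x _; rewrite lee_fin gk.
  by rewrite mean_fin// lee_fin mean_kern_le.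
have ip : L1 (kern p).
  apply/integrableP; split; first by apply/measurable_EFinP; exact: measurable_kern.
  under eq_integral do rewrite /= ger0_norm ?kern_ge0//.
  exact: le_lt_trans F (ltry _).
by split => //; rewrite -lee_fin -mean_fin.
Qed.

Lemma adm_vt p : vt p.1 <= p.2 -> adm mu t p.
Proof.
case: p => u v /= uv; have [iv Ev] := vt_fatou uv.
have v0 := le_trans (vt_ge0 u) uv; split => //=.
have [z|z] := eqVneq v 0.
  by rewrite z; apply: vt_no_atom; apply/eqP; rewrite eq_le vt_ge0 -z uv.
by apply: aeW => x; rewrite gt_eqF// kern_gt0.
Qed.

(** Were the mean strictly below [1/t], [kern_scale] would keep it at most [1/t] at a slightly
    smaller height, against the definition of [v_t] as an infimum. *)
Lemma mean_kern_vt u : 0 < vt u -> E (kern (u, vt u)) = t^-1.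
Proof.
move=> w0; have [iw Ew] := vt_fatou (lexx (vt u)).
apply/eqP; rewrite eq_le Ew/= leNgt; apply/negP => lt1.
set a := t * E (kern (u, vt u)).
have a0 : 0 <= a.
  by apply: mulr_ge0 (ltW t0) _; apply: Rintegral_ge0 => x _; exact: kern_ge0.
have a1 : a < 1 by rewrite -ltr_pdivlMl// mulr1.
(* This shrinking factor satisfies [r < 1] and [r^2 = a + (1 - a)^2 / 4 >= a]. *)
pose r := (1 + a) / 2.
have r0 : 0 < r by rewrite /r; lra.
have r1 : r < 1 by rewrite /r; lra.
have v0 : 0 < r * vt u by exact: mulr_gt0.
have vw : r * vt u < vt u by rewrite gtr_pMl.
have := mean_kern_gt v0 vw; apply/negP; rewrite -leNgt.
apply: (@le_trans _ _ (r ^- 2 * E (kern (u, vt u)))).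
  rewrite -meanZl//; apply: mean_le => [||x].
  - by apply: L1_kern; rewrite gt_eqF.
  - exact: L1Zl.
  - have -> : r ^- 2 = (vt u / (r * vt u)) ^+ 2.
      by field; rewrite !gt_eqF.
    exact: kern_scale (ltW vw).
rewrite ler_pdivrMl ?exprn_gt0// ler_pdivlMr// mulrC -/a.
have -> : r ^+ 2 = a + (1 - a) ^+ 2 / 4 by rewrite /r; field.
by rewrite lerDl divr_ge0// sqr_ge0.
Qed.

Hypothesis Hnd :
  ~ (exists a : R, forall A : set R, measurable A -> mu A = \d_a A).

Lemma mean_kern_lt u v : vt u < v -> E (kern (u, v)) < t^-1.
Proof.
move=> uv; pose w := (vt u + v) / 2.
have w0 : vt u < w by rewrite /w; lra.
have wv : w < v by rewrite /w; lra.
have wp := le_lt_trans (vt_ge0 u) w0; have vp := lt_trans wp wv.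
apply: lt_le_trans (mean_kern_le w0).
have iw : L1 (kern (u, w)) by apply: L1_kern; rewrite gt_eqF.
have iv : L1 (kern (u, v)) by apply: L1_kern; rewrite gt_eqF.
rewrite -subr_gt0 -meanB//.
apply: (@mean_gt0 _ mu Hnd _ 0 setT) => [|x||x _ /eqP].
- exact: L1B.
- by rewrite subr_ge0 kern_le// ltW.
- exact: aeW.
- by rewrite subr_eq0 gt_eqF// kern_lt.
Qed.

(** The mean at height [v] is strictly below [1/t] at [u] and Lipschitz in [u]; the radius is the
    gap divided by the Lipschitz constant. [vt_lower] is the mirror argument, and together they give
    continuity. *)
Lemma vt_upper u v : vt u < v ->
  exists2 d, 0 < d & forall u', `|u - u'| < d -> vt u' <= v.
Proof.
move=> uv; have v0 := le_lt_trans (vt_ge0 u) uv.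
have c0 : 0 < 2 * v ^- 3 by rewrite mulr_gt0// invr_gt0 exprn_gt0.
exists ((t^-1 - E (kern (u, v))) / (2 * v ^- 3)).
  by rewrite divr_gt0// subr_gt0 mean_kern_lt.
move=> u'; rewrite ltr_pdivlMr// mulrC => h; apply: vt_le => //.
by have := mean_kern_lipschitz u u' v0; rewrite ler_norml => /andP[]; lra.
Qed.

Lemma vt_lower u v : v < vt u ->
  exists2 d, 0 < d & forall u', `|u - u'| < d -> v <= vt u'.
Proof.
move=> uv; have [v0|v0] := leP v 0.
  by exists 1 => // u' _; exact: le_trans (vt_ge0 u').
have c0 : 0 < 2 * v ^- 3 by rewrite mulr_gt0// invr_gt0 exprn_gt0.
exists ((E (kern (u, v)) - t^-1) / (2 * v ^- 3)).
  by rewrite divr_gt0// subr_gt0 mean_kern_gt.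
move=> u'; rewrite ltr_pdivlMr// mulrC => h; rewrite leNgt; apply/negP.
move=> /mean_kern_lt h'.
by have := mean_kern_lipschitz u u' v0; rewrite ler_norml => /andP[]; lra.
Qed.

Lemma continuous_vt : continuous vt.
Proof.
move=> u; apply/cvgrPdist_le => e e0.
have [d d0 hd] : exists2 d, 0 < d & forall u', `|u - u'| < d -> vt u' <= vt u + e.
  by apply: vt_upper; rewrite ltrDl.
have [d' d0' hd'] : exists2 d, 0 < d & forall u', `|u - u'| < d -> vt u - e <= vt u'.
  by apply: vt_lower; rewrite ltrBlDr ltrDl.
apply/nbhs_ballP; exists (Num.min d d') => /=; first by rewrite lt_min d0.
move=> u' /=; rewrite /ball/= lt_min => /andP[/hd h /hd' h'].
by rewrite ler_norml; lra.
Qed.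

Lemma closure_Gammat : closure (Gammat mu t) `<=` [set p | vt p.1 <= p.2].
Proof.
have -> : [set p : R * R | vt p.1 <= p.2] =
    (fun p => p.2 - vt p.1) @^-1` [set x | 0 <= x].
  by apply/seteqP; split => p /=; rewrite subr_ge0.
set A := _ @^-1` _; have cA : closed A.
  apply: closed_comp => [p _|]; last exact: closed_ge.
  apply: cvgB; first exact: cvg_snd.
  by apply: (continuous_comp _ (@continuous_vt p.1)); exact: cvg_fst.
rewrite [X in _ `<=` X](closure_id A).1//; apply: closureS.
by move=> p /= /ltW; rewrite /A /= subr_ge0.
Qed.

End Boundary.

(** * Injectivity and continuity of [H], and the boundary map [f] *)

Section Holomorphic.
Context {R : realType} (mu : probability R R) (t : R).
Local Notation L1 f := (mu.-integrable setT (EFin \o f)).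
Local Notation E f := (Rintegral mu setT f).
Local Notation vt := (vt mu t).
Local Notation H := (Hmt mu t).
Local Notation f := (ft mu t).
Implicit Types (p q : R * R) (u v w x : R).

Hypothesis Hnd :
  ~ (exists a : R, forall A : set R, measurable A -> mu A = \d_a A).
Hypothesis t0 : 0 < t.

Lemma normr_le_hypot (a b x y : R) :
  x ^+ 2 + y ^+ 2 <= a ^+ 2 + b ^+ 2 -> `|x| <= `|a| + `|b|.
Proof.
move=> h; rewrite -ler_sqr ?nnegrE ?addr_ge0// sqrrD !real_normK ?num_real//.
have : 0 <= `|a| * `|b| *+ 2 by rewrite mulrn_wge0// mulr_ge0.
by have := sqr_ge0 y; lra.
Qed.

(** Here [(a, b)] is a difference of points and [(x, y)] that of their images. Each of [|x|], [|y|]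
    is at most one of [|a|], [|b|] plus their sum: three terms below [e / 3]. *)
Lemma normr_le_of_nonexpansive (a b x y e : R) : `|a| < e / 3 -> `|b| < e / 3 ->
  (a - x) ^+ 2 + (b - y) ^+ 2 <= a ^+ 2 + b ^+ 2 -> `|x| <= e /\ `|y| <= e.
Proof.
move=> ae be h; have h1 := normr_le_hypot h.
have h2 : `|b - y| <= `|a| + `|b|.
  by apply: (@normr_le_hypot _ _ _ (a - x)); rewrite [leLHS]addrC.
move: (ler_norm a) (lerNnormlW (lexx `|a|)) => a1 a2.
move: (ler_norm b) (lerNnormlW (lexx `|b|)) => b1 b2.
move: h1 h2; rewrite !ler_norml => /andP[c1 c2] /andP[d1 d2].
by split; apply/andP; split; lra.
Qed.

Lemma Hmt_contract p q : vt p.1 <= p.2 -> vt q.1 <= q.2 -> p <> q ->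
  ((p.1 - q.1) - ((H p).1 - (H q).1)) ^+ 2
  + ((p.2 - q.2) - ((H p).2 - (H q).2)) ^+ 2
  < (p.1 - q.1) ^+ 2 + (p.2 - q.2) ^+ 2.
Proof.
move=> /(adm_vt t0) ap /(adm_vt t0) aq /(tG_contract Hnd t0 ap aq).
by congr (_ < _); rewrite /Hmt /=; ring.
Qed.

Lemma Hmt_nonexpansive p q : vt p.1 <= p.2 -> vt q.1 <= q.2 ->
  ((p.1 - q.1) - ((H p).1 - (H q).1)) ^+ 2
  + ((p.2 - q.2) - ((H p).2 - (H q).2)) ^+ 2
  <= (p.1 - q.1) ^+ 2 + (p.2 - q.2) ^+ 2.
Proof.
move=> ap aq; have [->|/eqP pq] := eqVneq p q; last exact/ltW/Hmt_contract.
by rewrite !subrr !expr0n.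
Qed.

Lemma Hmt_inj p q : vt p.1 <= p.2 -> vt q.1 <= q.2 -> H p = H q -> p = q.
Proof.
move=> ap aq e; apply/eqP; apply/negPn/negP => /eqP pq.
have := Hmt_contract ap aq pq.
by rewrite e !subrr !subr0 ltxx.
Qed.

Lemma Hmt_continuous (A : set (R * R)) : A `<=` [set p | vt p.1 <= p.2] ->
  {within A, continuous H}.
Proof.
move=> Ae; apply/subspace_continuousP => p Ap.
apply/cvgrPdist_le => e e0.
rewrite near_withinE; apply/nbhs_ballP; exists (e / 3) => /=.
  by rewrite divr_gt0.
move=> q [] /=; rewrite /ball/= => h1 h2 Aq.
have h := Hmt_nonexpansive (Ae _ Ap) (Ae _ Aq).
have [l1 l2] := normr_le_of_nonexpansive h1 h2 h.
by rewrite prod_normE ge_max; apply/andP; split; [exact: l1|exact: l2].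
Qed.

(** The imaginary part is [v (1 + t E (kern (u, v)))]. At [v = v_t(u) > 0] the bracket equals 2; at
    [v = 0] both sides vanish. *)
Lemma Hmt_im_graph u : (H (u, vt u)).2 = 2 * vt u.
Proof.
rewrite /Hmt /= mulrN opprK mulr_natl mulr2n; congr (_ + _).
have [iv _] := vt_fatou t0 (lexx (vt u)).
rewrite -[X in Rintegral _ _ X]/(fun x => vt u * kern (u, vt u) x) meanZl//.
have [->|v0] := eqVneq (vt u) 0; first by rewrite mul0r mulr0.
rewrite mean_kern_vt//; first by rewrite mulrCA divff ?mulr1// gt_eqF.
by rewrite lt_neqAle eq_sym v0 vt_ge0.
Qed.

Lemma Hmt_graph u : H (u, vt u) = (f u, 2 * vt u).
Proof. by rewrite [LHS]surjective_pairing Hmt_im_graph. Qed.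

(** On the graph, [id - H] merely negates the imaginary difference. Those squares cancel in the
    contraction, leaving [|du - df| < |du|]. *)
Lemma ft_secant u u' : u < u' -> 0 < f u' - f u < 2 * (u' - u).
Proof.
move=> uu.
have uN : (u', vt u') <> (u, vt u) by move=> [e _]; move: uu; rewrite e ltxx.
have := @Hmt_contract (u', vt u') (u, vt u) (lexx _) (lexx _) uN.
rewrite !Hmt_graph /=; move: (f u) (f u') (vt u) (vt u') => a a' b b'.
rewrite (_ : b' - b - _ = - (b' - b)); last by ring.
rewrite sqrrN ltrD2r -(real_normK (num_real (u' - u))).
rewrite -(real_normK (num_real (u' - u - _))).
rewrite ltr_pXn2r ?nnegrE// (gtr0_norm (_ : 0 < u' - u)) ?subr_gt0//.
by rewrite ltr_norml => /andP[h1 h2]; apply/andP; split; lra.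
Qed.

Lemma ft_increasing : {homo f : x y / x < y}.
Proof. by move=> x y /ft_secant/andP[]; rewrite subr_gt0. Qed.

Lemma ft_lipschitz u u' : `|f u - f u'| <= 2 * `|u - u'|.
Proof.
wlog uu : u u' / u < u'.
  move=> w; have [|uu|->] := ltgtP u u'; first exact: w.
    by rewrite distrC (distrC u); exact: w.
  by rewrite !subrr normr0 mulr0.
rewrite distrC (distrC u); have /andP[h1 h2] := ft_secant uu.
by rewrite gtr0_norm// gtr0_norm ?subr_gt0// ltW.
Qed.

Lemma ft_continuous : continuous f.
Proof.
move=> u; apply/cvgrPdist_le => e e0; apply/nbhs_ballP; exists (e / 2) => /=.
  by rewrite divr_gt0.
move=> u'; rewrite /ball/= => h; apply: (le_trans (ft_lipschitz _ _)).
by lra.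
Qed.

(** The displacement is [t |Re G| <= t (1 + E (kern p)) <= t (1 + 1/t)]. This gives surjectivity by
    intermediate values and, later, the decay of [phi]. *)
Lemma Hmt_re_bound p : vt p.1 <= p.2 -> `|(H p).1 - p.1| <= t + 1.
Proof.
move=> /(adm_vt t0)[_ ip Ep _].
rewrite /Hmt /= addrAC subrr sub0r normrN normrM gtr0_norm//.
apply: (@le_trans _ _ (t * (1 + t^-1))); last first.
  by rewrite mulrDr mulr1 divff// gt_eqF.
rewrite ler_pM2l//; apply: (le_trans (mean_norm (L1_rker ip))).
apply: (@le_trans _ _ (E (fun x => 1 + kern p x))).
  apply: mean_le; [exact: L1_norm (L1_rker ip)| |exact: rker_le].
  by apply: L1D => //; exact: L1_cst.
by rewrite meanD ?mean_cst ?lerD2l//; exact: L1_cst.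
Qed.

Lemma surj_of_bounded_drift (g : R -> R) (c : R) : continuous g ->
  (forall x, `|g x - x| <= c) -> forall y, exists x, g x = y.
Proof.
move=> cg gc y.
have c0 : 0 <= c by exact: le_trans (normr_ge0 _) (gc 0).
have ab : y - c <= y + c by lra.
have := gc (y - c); have := gc (y + c); rewrite !ler_norml => /andP[h1 h2] /andP[h3 h4].
have [||x _ gx] := @IVT R g (y - c) (y + c) y ab.
- exact: continuous_subspaceT.
- by rewrite ge_min le_max; apply/andP; split; apply/orP; [left|right]; lra.
by exists x.
Qed.

Lemma ft_surj y : exists x, f x = y.
Proof.
apply: surj_of_bounded_drift ft_continuous _ y => x.
exact: (@Hmt_re_bound (x, vt x)).
Qed.

End Holomorphic.

(** * Differentiability of [f] where [v_t] is positive *)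

Section Derivative.
Context {R : realType} (mu : probability R R) (t : R).
Local Notation L1 f := (mu.-integrable setT (EFin \o f)).
Local Notation E f := (Rintegral mu setT f).
Local Notation vt := (vt mu t).
Local Notation H := (Hmt mu t).
Local Notation f := (ft mu t).
Implicit Types (p q : R * R) (u v w x : R).

Lemma rker_lipschitz p q x c : 0 < c -> c <= p.2 -> c <= q.2 ->
  `|rker p x - rker q x| <= 2 * c ^- 2 * (`|p.1 - q.1| + `|p.2 - q.2|) /\
  `|iker p x - iker q x| <= 2 * c ^- 2 * (`|p.1 - q.1| + `|p.2 - q.2|).
Proof.
move=> c0 pc qc; have p0 := lt_le_trans c0 pc; have q0 := lt_le_trans c0 qc.
have kp : kern p x != 0 by rewrite gt_eqF// kern_gt0// gt_eqF.
have kq : kern q x != 0 by rewrite gt_eqF// kern_gt0// gt_eqF.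
have inv_c (y : R) : c <= y -> y^-1 <= c^-1.
  by move=> cy; rewrite lef_pV2// posrE (lt_le_trans c0).
have rp := le_trans (rker_le_inv x p0) (inv_c _ pc).
have rq := le_trans (rker_le_inv x q0) (inv_c _ qc).
have ip := le_trans (iker_le_inv x p0) (inv_c _ pc).
have iq := le_trans (iker_le_inv x q0) (inv_c _ qc).
have bnd (a b a' b' : R) : `|a| <= c^-1 -> `|b| <= c^-1 -> `|a'| <= c^-1 ->
    `|b'| <= c^-1 -> `|a * b + a' * b'| <= 2 * c ^- 2.
  move=> ha hb ha' hb'; apply: (le_trans (ler_normD _ _)).
  rewrite !normrM (_ : 2 * c ^- 2 = c^-1 * c^-1 + c^-1 * c^-1); last first.
    by rewrite -exprVn expr2; ring.
  by apply: lerD; apply: ler_pM.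
have lin (a b d e : R) : `|a| <= 2 * c ^- 2 -> `|b| <= 2 * c ^- 2 ->
    `|d * a + e * b| <= 2 * c ^- 2 * (`|d| + `|e|).
  move=> ha hb; apply: (le_trans (ler_normD _ _)); rewrite !normrM mulrDr.
  by rewrite !(mulrC (2 * _)); apply: lerD; apply: ler_wpM2l.
have hA : `|rker p x * rker q x - iker p x * iker q x| <= 2 * c ^- 2.
  by rewrite -mulNr; apply: bnd => //; rewrite normrN.
have hB : `|rker p x * iker q x + iker p x * rker q x| <= 2 * c ^- 2.
  exact: bnd.
rewrite resolvent_re// resolvent_im// (distrC p.1) (distrC p.2).
split; first exact: lin.
by rewrite -mulrN; apply: lin => //; rewrite normrN.
Qed.

Lemma mean_ker2_lipschitz p q c : 0 < c -> c <= p.2 -> c <= q.2 ->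
  `|E (rker2 q q) - E (rker2 p q)|
    <= 4 * c ^- 3 * (`|p.1 - q.1| + `|p.2 - q.2|) /\
  `|E (iker2 q q) - E (iker2 p q)|
    <= 4 * c ^- 3 * (`|p.1 - q.1| + `|p.2 - q.2|).
Proof.
move=> c0 pc qc; have p0 := lt_le_trans c0 pc; have q0 := lt_le_trans c0 qc.
have ip : L1 (kern p) by apply: L1_kern; rewrite gt_eqF.
have iq : L1 (kern q) by apply: L1_kern; rewrite gt_eqF.
set D := `|p.1 - q.1| + `|p.2 - q.2|.
have bnd x (a b a' b' : R) : `|a| <= 2 * c ^- 2 * D -> `|b| <= c^-1 ->
    `|a'| <= 2 * c ^- 2 * D ->
    `|b'| <= c^-1 -> `|a * b + a' * b'| <= 4 * c ^- 3 * D.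
  move=> ha hb ha' hb'; apply: (le_trans (ler_normD _ _)); rewrite !normrM.
  rewrite (_ : 4 * c ^- 3 * D = 2 * c ^- 2 * D * c^-1 + 2 * c ^- 2 * D * c^-1).
    by apply: lerD; apply: ler_pM.
  by field; rewrite gt_eqF.
have inv_c : q.2^-1 <= c^-1 by rewrite lef_pV2.
have rq x := le_trans (rker_le_inv x q0) inv_c.
have iq' x := le_trans (iker_le_inv x q0) inv_c.
have close (g h : R -> R) : L1 g -> L1 h ->
    (forall x, `|h x - g x| <= 4 * c ^- 3 * D) ->
    `|E g - E h| <= 4 * c ^- 3 * D.
  move=> ig ih gh; rewrite -meanB//.
  apply: (le_trans (mean_norm (L1B ig ih))); rewrite -[leRHS](mean_cst mu).
  by apply: mean_le => [||x]; [exact: L1_norm (L1B ig ih)|exact: L1_cst|rewrite distrC].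
split; apply: close; try exact: L1_rker2; try exact: L1_iker2.
  move=> x; have [h1 h2] := rker_lipschitz x c0 pc qc.
  rewrite (_ : _ - _ = (rker p x - rker q x) * rker q x
                       + (- (iker p x - iker q x)) * iker q x); last first.
    by rewrite /rker2; ring.
  by apply: bnd => //; rewrite normrN.
move=> x; have [h1 h2] := rker_lipschitz x c0 pc qc.
rewrite (_ : _ - _ = (rker p x - rker q x) * iker q x
                     + (iker p x - iker q x) * rker q x); last first.
  by rewrite /iker2; ring.
exact: bnd.
Qed.

Hypothesis Hnd :
  ~ (exists a : R, forall A : set R, measurable A -> mu A = \d_a A).
Hypothesis t0 : 0 < t.

Lemma cvg_mean_ker2 u0 : 0 < vt u0 ->
  E (rker2 (u, vt u) (u0, vt u0)) @[u --> u0]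
    --> E (rker2 (u0, vt u0) (u0, vt u0)) /\
  E (iker2 (u, vt u) (u0, vt u0)) @[u --> u0]
    --> E (iker2 (u0, vt u0) (u0, vt u0)).
Proof.
(* By continuity of [v_t], the graph near [u0] stays above half its height there, so a single
   Lipschitz constant serves for all nearby points. *)
move=> v0; pose c := vt u0 / 2.
have c0 : 0 < c by rewrite divr_gt0.
have cq : c <= vt u0 by rewrite /c; lra.
have cC := continuous_vt t0 Hnd.
have D0 : 4 * c ^- 3 * (`|u - u0| + `|vt u - vt u0|) @[u --> u0] -->
    4 * c ^- 3 * (`|u0 - u0| + `|vt u0 - vt u0|).
  apply: cvgM; first exact: cvg_cst.
  apply: cvgD; apply: cvg_norm; apply: cvgB; try exact: cvg_cst.
    exact: cvg_id.
  exact: cC.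
rewrite !subrr normr0 addr0 mulr0 in D0.
have nc : \forall u \near u0, c <= vt u.
  have /cvgrPdist_le/(_ c c0) := cC u0; apply: filterS => u.
  by rewrite ler_norml /c; lra.
have sq (g : R -> R) : (forall u, c <= vt u ->
     `|g u0 - g u| <= 4 * c ^- 3 * (`|u - u0| + `|vt u - vt u0|)) ->
    g u @[u --> u0] --> g u0.
  move=> h; apply/cvgrPdist_le => e e0.
  have /cvgrPdist_le/(_ e e0) := D0; apply: filterS2 nc => u cu.
  rewrite sub0r normrN => /(le_trans (ler_norm _)); apply: le_trans; exact: h.
split; [apply: (sq (fun u => E (rker2 (u, vt u) (u0, vt u0))))|
        apply: (sq (fun u => E (iker2 (u, vt u) (u0, vt u0))))] => u cu.
  by have [] := @mean_ker2_lipschitz (u, vt u) (u0, vt u0) c c0 cu cq.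
by have [] := @mean_ker2_lipschitz (u, vt u) (u0, vt u0) c c0 cu cq.
Qed.

(* On the graph [H (p) - H (q) = (p - q) (1 + P - i Q)] has imaginary part
   [2 (p.2 - q.2)]; eliminating [p.2 - q.2] gives this real secant slope. *)
Lemma ft_secantE u u0 : u != u0 -> 0 < vt u0 ->
  let P := t * E (rker2 (u, vt u) (u0, vt u0)) in
  let Q := t * E (iker2 (u, vt u) (u0, vt u0)) in
  f u - f u0 = (u - u0) * (1 + P - Q ^+ 2 / (1 - P)).
Proof.
move=> uu0 v0; set A := E _; set B := E _ => P Q.
have ap := adm_vt t0 (lexx (vt (u, vt u).1)).
have aq := adm_vt t0 (lexx (vt (u0, vt u0).1)).
have ne : ~ ((u, vt u) = (u0, vt u0) /\ (u, vt u).2 = 0).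
  by move=> [[e _] _]; move: uu0; rewrite e eqxx.
have := secant_lt1 Hnd t0 ap aq ne; rewrite -/P -/Q => PQ.
have P1 : 1 - P != 0.
  rewrite subr_eq0; apply/eqP => e; move: PQ; rewrite -e.
  by have := sqr_ge0 Q; lra.
have [_ ip _ np] := ap; have [_ iq _ nq] := aq.
have := ReG_sub ip iq np nq; have := ImG_sub ip iq np nq.
have := Hmt_im_graph mu t0 u; have := Hmt_im_graph mu t0 u0.
rewrite -/A -/B /ft /Hmt /= /P /Q in P1 PQ *.
move: (ReG mu (u, vt u)) (ReG mu (u0, vt u0)) => r r'.
move: (ImG mu (u, vt u)) (ImG mu (u0, vt u0)) => i i'.
move: A B (vt u) (vt u0) @P @Q P1 PQ => A B v v' P Q P1 PQ e1 e2 e3 e4.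
have e3' := congr1 ( *%R t) e3; have e4' := congr1 ( *%R t) e4.
have k : (v - v') * (1 - t * A) = - ((u - u0) * (t * B)) by lra.
have -> : u - t * r - (u0 - t * r') = (u - u0) * (1 + t * A) + (v - v') * (t * B).
  by lra.
apply: (mulIf P1); rewrite mulrDl mulrAC [in X in _ + X = _]mulrAC k.
by field.
Qed.

(** The secant slope of [ft_secantE] is continuous in the means, so it converges to its value at
    coincident points; [secant_lt1] with [p = q] bounds that value. *)
Lemma ft_derive u0 : 0 < vt u0 ->
  exists d : R, is_derive u0 1 f d /\ 0 < d < 2.
Proof.
move=> v0.
have [cP cQ] := cvg_mean_ker2 v0.
have aq := adm_vt t0 (lexx (vt (u0, vt u0).1)).
have ne : ~ ((u0, vt u0) = (u0, vt u0) /\ (u0, vt u0).2 = 0).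
  by move=> [_ /= e]; move: v0; rewrite e ltxx.
have := secant_lt1 Hnd t0 aq aq ne.
pose P u := t * E (rker2 (u, vt u) (u0, vt u0)).
pose Q u := t * E (iker2 (u, vt u) (u0, vt u0)).
rewrite -/(P u0) -/(Q u0) => PQ.
have P1 : P u0 < 1 by have := sqr_ge0 (Q u0); nra.
have P1' : 1 - P u0 != 0 by rewrite gt_eqF// subr_gt0.
pose s u := 1 + P u - Q u ^+ 2 / (1 - P u).
have cs : s u @[u --> u0] --> s u0.
  have cP' : P u @[u --> u0] --> P u0 by apply: cvgM => //; exact: cvg_cst.
  have cQ' : Q u @[u --> u0] --> Q u0 by apply: cvgM => //; exact: cvg_cst.
  apply: cvgB; first by apply: cvgD => //; exact: cvg_cst.
  apply: cvgM; first by apply: (cvgM (f := Q) (g := Q)).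
  by apply: cvgV => //; apply: cvgB => //; exact: cvg_cst.
have c : (fun h => h^-1 *: ((f \o shift u0) (h *: 1) - f u0)) @ 0^' --> s u0.
  have cs' : s (h + u0) @[h --> 0^'] --> s u0.
    apply: cvg_within_filter.
    have sh : h + u0 @[h --> (0 : R)] --> u0.
      by rewrite -[X in _ --> X]add0r; apply: cvgD; [exact: cvg_id|exact: cvg_cst].
    exact: (cvg_comp _ _ sh cs).
  apply: cvg_trans cs'; apply: near_eq_cvg.
  near=> h; have h0 : h != 0 by near: h; exact: nbhs_dnbhs_neq.
  rewrite /= /GRing.scale /= mulr1 ft_secantE//; last first.
    by rewrite -subr_eq0 addrK.
  by rewrite addrK mulKf.
exists (s u0); split.
  split; first exact: cvgP c.
  exact: cvg_lim c.
(* This form is positive because [P^2 + Q^2 < 1]; the original form is at most [1 + P < 2]. *)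
have sE : s u0 = (1 - P u0 ^+ 2 - Q u0 ^+ 2) / (1 - P u0).
  by rewrite /s; field.
apply/andP; split; first by rewrite sE divr_gt0 ?subr_gt0//; lra.
have : 0 <= Q u0 ^+ 2 / (1 - P u0) by rewrite divr_ge0 ?sqr_ge0// subr_ge0 ltW.
by rewrite /s; lra.
Unshelve. all: by end_near.
Qed.

End Derivative.

(** * Continuation of [H] below the graph and its surjectivity *)

Section Extension.
Context {R : realType} (mu : probability R R) (t : R).
Local Notation L1 f := (mu.-integrable setT (EFin \o f)).
Local Notation E f := (Rintegral mu setT f).
Local Notation vt := (vt mu t).
Local Notation H := (Hmt mu t).
Local Notation f := (ft mu t).
Implicit Types (p q : R * R) (u v w x y : R).

Lemma probability_tight (d : R) : 0 < d ->
  exists2 M, 0 < M & fine (mu [set x | M < `|x|]) <= d.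
Proof.
move=> d0; pose F (n : nat) := [set x : R | n.+1%:R < `|x|].
have FE n : F n = ~` `[- n.+1%:R, n.+1%:R].
  apply/seteqP; split => x; rewrite /F /= in_itv /= -ler_norml ltNge.
    by move/negP.
  by move/negP.
have mF n : measurable (F n) by rewrite FE; apply: measurableC.
have F0 : \bigcap_n F n = set0.
  apply/seteqP; split => // x Fx.
  pose n := Num.bound `|x|.
  have := Fx n I; rewrite /F /= ltNge => /negP; apply; apply: ltW.
  by apply: lt_trans (archi_boundP (normr_ge0 x)) _; rewrite ltr_nat.
have dF : nonincreasing_seq F.
  move=> m n mn; apply/subsetPset => x; rewrite /F /=.
  by apply: le_lt_trans; rewrite ler_nat ltnS.
have mF0 : (mu (F 0%N) < +oo)%E by rewrite (le_lt_trans (probability_le1 _ _)) ?ltry.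
have mcap : measurable (\bigcap_n F n) by rewrite F0.
have := nonincreasing_cvg_mu mF0 mF mcap dF; rewrite F0 measure0.
move=> /fine_cvgP[_ /cvgrPdist_le/(_ d d0)[n _ /(_ n (leqnn n))]].
rewrite /= sub0r normrN => /(le_trans (ler_norm _)) h.
by exists n.+1%:R.
Qed.

Hypothesis Hnd :
  ~ (exists a : R, forall A : set R, measurable A -> mu A = \d_a A).
Hypothesis t0 : 0 < t.

(* The two formulas agree on the graph of [v_t]; the continuation below it lets
   the intermediate value theorem run on whole horizontal lines. *)
Definition Hext p : R * R := if vt p.1 <= p.2 then H p else (f p.1, 2 * p.2).

Lemma Hext_epi p : vt p.1 <= p.2 -> Hext p = H p.
Proof. by rewrite /Hext => ->. Qed.

Lemma Hext_hypo p : p.2 <= vt p.1 -> Hext p = (f p.1, 2 * p.2).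
Proof.
rewrite /Hext; case: p => u v /= vu; case: ifPn => // uv.
have -> : v = vt u by apply/eqP; rewrite eq_le vu uv.
exact: Hmt_graph.
Qed.

Lemma ft_drift u u' : (u - u' - (f u - f u')) ^+ 2 <= (u - u') ^+ 2.
Proof.
have [uu|uu|->] := ltgtP u u'; last by rewrite !subrr.
  by have := ft_secant Hnd t0 uu; move: (f u) (f u') => a b /andP[]; nra.
by have := ft_secant Hnd t0 uu; move: (f u) (f u') => a b /andP[]; nra.
Qed.

Lemma continuous_of_drift (g : R -> R) :
  (forall u u', (u - u' - (g u - g u')) ^+ 2 <= (u - u') ^+ 2) -> continuous g.
Proof.
move=> gd u; apply/cvgrPdist_le => e e0; apply/nbhs_ballP; exists (e / 2) => /=.
  by rewrite divr_gt0.
move=> u'; rewrite /ball/= => h.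
have := gd u u'; rewrite -(real_normK (num_real (u - u' - _))).
rewrite -(real_normK (num_real (u - u'))) ler_pXn2r ?nnegrE// => h2.
have h3 := le_lt_trans h2 h; move: h3 h.
rewrite !ltr_norml ler_norml => /andP[a1 a2] /andP[b1 b2].
by apply/andP; split; lra.
Qed.

(** Intermediate value theorem for the height above the graph along the segment from [q] to [p]. *)
Lemma vt_crossing p q : vt p.1 < p.2 -> q.2 < vt q.1 ->
  exists s, [/\ 0 < s, s < 1 &
    vt (q.1 + s * (p.1 - q.1)) = q.2 + s * (p.2 - q.2)].
Proof.
move=> pE qE.
pose g s := q.2 + s * (p.2 - q.2) - vt (q.1 + s * (p.1 - q.1)).
have lin (a b : R) : continuous (fun s : R => a + s * b).
  move=> s; apply: cvgD; first exact: cvg_cst.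
  by apply: cvgM; [exact: cvg_id|exact: cvg_cst].
have cg : continuous g.
  move=> s; apply: cvgB; first exact: lin.
  by apply: (continuous_comp (lin _ _ s)); exact: continuous_vt.
have g00 : g 0 < 0 by rewrite /g !mul0r !addr0 subr_lt0.
have g10 : 0 < g 1 by rewrite /g !mul1r !subrKC subr_gt0.
have [||s] := @IVT R g 0 1 0 ler01.
- exact: continuous_subspaceT.
- by move: (g 0) (g 1) g00 g10 => a b /ltW a0 /ltW b0; rewrite ge_min a0 le_max b0 orbT.
rewrite in_itv /= => /andP[s0 s1] gs.
exists s; split.
- by rewrite lt_neqAle s0 andbT; apply/eqP => e; move: g00; rewrite [X in g X]e gs ltxx.
- by rewrite lt_neqAle s1 andbT; apply/eqP => e; move: g10; rewrite -[X in g X]e gs ltxx.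
- by apply/esym/eqP; rewrite -subr_eq0 -/(g s) gs.
Qed.

(** The triangle inequality in squared form. It follows from [(1-s)|x|^2 + s|y|^2 - s(1-s)|x+y|^2 =
    |(1-s)x - sy|^2]. *)
Lemma strict_minkowski (s a b x1 x2 y1 y2 z1 z2 : R) : 0 < s -> s < 1 ->
  x1 ^+ 2 + x2 ^+ 2 < s ^+ 2 * (a ^+ 2 + b ^+ 2) ->
  y1 ^+ 2 + y2 ^+ 2 <= (1 - s) ^+ 2 * (a ^+ 2 + b ^+ 2) ->
  z1 = x1 + y1 -> z2 = x2 + y2 -> z1 ^+ 2 + z2 ^+ 2 < a ^+ 2 + b ^+ 2.
Proof.
move=> s0 s1 hx hy -> ->; have s1' : 0 < 1 - s by rewrite subr_gt0.
rewrite -(ltr_pM2l (mulr_gt0 s0 s1')).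
have h1 : (1 - s) * (x1 ^+ 2 + x2 ^+ 2) < (1 - s) * (s ^+ 2 * (a ^+ 2 + b ^+ 2)).
  by rewrite ltr_pM2l.
have h2 : s * (y1 ^+ 2 + y2 ^+ 2) <= s * ((1 - s) ^+ 2 * (a ^+ 2 + b ^+ 2)).
  by rewrite ler_pM2l.
have := sqr_ge0 ((1 - s) * x1 - s * y1); have := sqr_ge0 ((1 - s) * x2 - s * y2).
lra.
Qed.

(** The segment is cut at a crossing point [r] of the graph, where both formulas for [Hext] agree.
    The piece from [r] to [p] is strictly contracted and the other is not expanded; the two lengths
    add up to [|p - q|]. *)
Lemma Hext_contract_across p q : vt p.1 < p.2 -> q.2 < vt q.1 ->
  ((p.1 - q.1) - ((Hext p).1 - (Hext q).1)) ^+ 2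
  + ((p.2 - q.2) - ((Hext p).2 - (Hext q).2)) ^+ 2
  < (p.1 - q.1) ^+ 2 + (p.2 - q.2) ^+ 2.
Proof.
move=> pE qE; have [s [s0 s1 rE]] := vt_crossing pE qE.
set r1 := q.1 + s * _ in rE; set r2 := q.2 + s * _ in rE.
have pr : p <> (r1, r2) by move=> e; move: pE; rewrite e /= rE ltxx.
have rE' : vt (r1, r2).1 <= (r1, r2).2 by rewrite /= rE.
have := Hmt_contract Hnd t0 (ltW pE) rE' pr.
have -> : H (r1, r2) = (f r1, 2 * r2) by rewrite -rE Hmt_graph.
rewrite (Hext_epi (ltW pE)) (Hext_hypo (ltW qE)) /= => hx.
have hy := ft_drift r1 q.1.
have hx' : (p.1 - r1 - ((H p).1 - f r1)) ^+ 2 + (p.2 - r2 - ((H p).2 - 2 * r2)) ^+ 2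
   < (1 - s) ^+ 2 * ((p.1 - q.1) ^+ 2 + (p.2 - q.2) ^+ 2).
  by apply: lt_le_trans hx _; rewrite le_eqVlt; apply/orP; left; apply/eqP;
    rewrite /r1 /r2; ring.
have hy' : (r1 - q.1 - (f r1 - f q.1)) ^+ 2 + (r2 - q.2 - (2 * r2 - 2 * q.2)) ^+ 2
   <= (1 - (1 - s)) ^+ 2 * ((p.1 - q.1) ^+ 2 + (p.2 - q.2) ^+ 2).
  rewrite (_ : r2 - q.2 - _ = - (r2 - q.2)); last by ring.
  rewrite sqrrN; apply: le_trans (lerD hy (lexx _)) _.
  by rewrite le_eqVlt; apply/orP; left; apply/eqP; rewrite /r1 /r2; ring.
have s0' : 0 < 1 - s by rewrite subr_gt0.
have s1' : 1 - s < 1 by rewrite gtrBl.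
apply: (strict_minkowski s0' s1' hx' hy').
  by rewrite [(H p).1]/=; move: (f r1) (f q.1) (ReG mu p) => *; ring.
by rewrite [(H p).2]/=; move: (ImG mu p) => *; ring.
Qed.

Lemma Hext_nonexpansive p q :
  ((p.1 - q.1) - ((Hext p).1 - (Hext q).1)) ^+ 2
  + ((p.2 - q.2) - ((Hext p).2 - (Hext q).2)) ^+ 2
  <= (p.1 - q.1) ^+ 2 + (p.2 - q.2) ^+ 2.
Proof.
wlog pq : p q / vt p.1 < p.2 \/ q.2 <= vt q.1.
  move=> w; have [pE|pE] := ltP (vt p.1) p.2; first by apply: w; left.
  have := w q p (or_intror pE); congr (_ <= _); ring.
have [pE|pE] := ltP (vt p.1) p.2.
  have [qE|qE] := leP (vt q.1) q.2; last exact/ltW/Hext_contract_across.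
  rewrite (Hext_epi (ltW pE)) (Hext_epi qE); apply: Hmt_nonexpansive => //.
  exact: ltW.
have qE : q.2 <= vt q.1 by case: pq => [/lt_geF|//]; rewrite pE.
rewrite !Hext_hypo//= (_ : p.2 - q.2 - _ = - (p.2 - q.2)); last by ring.
by rewrite sqrrN lerD2r ft_drift.
Qed.

Lemma Hext_re_bound p : `|(Hext p).1 - p.1| <= t + 1.
Proof.
have [pE|/ltW pE] := leP (vt p.1) p.2.
  by rewrite Hext_epi//; exact: Hmt_re_bound.
by rewrite Hext_hypo//=; apply: (@Hmt_re_bound _ _ _ t0 (p.1, vt p.1)) => /=.
Qed.

Lemma Hext_im_bound p : 0 <= p.2 -> p.2 <= (Hext p).2 <= 2 * p.2.
Proof.
move=> p0; have [pE|/ltW pE] := leP (vt p.1) p.2; last first.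
  by rewrite Hext_hypo//= lexx andbT; lra.
have [_ ip Ep _] := adm_vt t0 pE.
rewrite Hext_epi// /Hmt /= mulrN opprK.
rewrite -[X in Rintegral _ _ X]/(fun x => p.2 * kern p x) meanZl//.
have e0 : 0 <= E (kern p) by apply: Rintegral_ge0 => x _; exact: kern_ge0.
have e1 : t * E (kern p) <= 1 by rewrite -ler_pdivlMl// mulr1.
move: (p.2) (E _) p0 e0 e1 => v e p0 e0 e1.
have h0 : 0 <= v * (t * e) by rewrite !mulr_ge0// ltW.
have h1 : v * (t * e) <= v * 1 by rewrite ler_wpM2l.
by apply/andP; split; lra.
Qed.

(** A first use of intermediate values, on each horizontal line, finds a point with image abscissa
    [x]; a second one, in the height, reaches ordinate [y]. *)
Lemma Hext_surj x y : 0 < y -> exists p, Hext p = (x, y).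
Proof.
move=> y0.
have /choice[U Ux] : forall v, exists u, (Hext (u, v)).1 = x.
  move=> v; apply: (@surj_of_bounded_drift _ _ (t + 1)).
    apply: continuous_of_drift => u u'.
    have := Hext_nonexpansive (u, v) (u', v).
    move: (Hext (u, v)) (Hext (u', v)) => a b /=; rewrite subrr expr0n addr0.
    by apply: le_trans; rewrite lerDl sqr_ge0.
  by move=> u; exact: (@Hext_re_bound (u, v)).
(* The choice [U] need not be continuous: all images share the abscissa [x], so the [(U v - U v')^2]
   terms cancel from nonexpansiveness and only heights remain. *)
have cy : continuous (fun v => (Hext (U v, v)).2).
  apply: continuous_of_drift => v v'.
  have := Hext_nonexpansive (U v, v) (U v', v'); move: (Ux v) (Ux v').
  move: (Hext (U v, v)) (Hext (U v', v')) => a b /= -> ->.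
  by rewrite subrr subr0 lerD2l.
(* Since the image ordinate lies between [v] and [2 v], the heights [y / 2] and [y] bracket the
   value [y]. *)
have yy : y / 2 <= y by lra.
have [||v _ vy] := @IVT R (fun v => (Hext (U v, v)).2) (y / 2) y y yy.
- exact: continuous_subspaceT.
- have h1 : 0 <= (U (y / 2), y / 2).2 by rewrite /= divr_ge0// ltW.
  have h2 : 0 <= (U y, y).2 by rewrite /= ltW.
  have /andP[_ /= h3] := Hext_im_bound h1; have /andP[/= h4 _] := Hext_im_bound h2.
  move: (Hext _).2 (Hext _).2 h3 h4 => a b h3 h4.
  by rewrite ge_min le_max h4 orbT andbT; apply/orP; left; lra.
by exists (U v, v); rewrite [LHS]surjective_pairing Ux vy.
Qed.

Lemma Hmt_conj p : vt p.1 <= p.2 -> H (p.1, - p.2) = ((H p).1, - (H p).2).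
Proof.
move=> /(adm_vt t0)[_ ip _ _]; rewrite /Hmt /=.
have -> : ReG mu (p.1, - p.2) = ReG mu p.
  by congr Rintegral; apply/funext => x /=; rewrite sqrrN.
have -> : ImG mu (p.1, - p.2) = - ImG mu p.
  rewrite /ImG; congr (- _); rewrite -[RHS]mulN1r -meanZl; last exact: L1_iker.
  by congr Rintegral; apply/funext => x /=; rewrite sqrrN mulN1r mulNr.
by congr (_, _); ring.
Qed.

End Extension.

(** * Decay of [phi] and the images of the graph and regions *)

Section Image.
Context {R : realType} (mu : probability R R) (t : R).
Local Notation L1 f := (mu.-integrable setT (EFin \o f)).
Local Notation E f := (Rintegral mu setT f).
Local Notation vt := (vt mu t).
Local Notation H := (Hmt mu t).
Local Notation f := (ft mu t).
Implicit Types (p q : R * R) (u v w x y : R).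

Hypothesis t0 : 0 < t.

(** The mean at height [e] splits into two halves of [1/t]: outside [[-M, M]] the mass is at most
    [e^2 / (2t)] and the kernel at most [e^-2]; inside, [|u - x| >= 2t + 1] and
    [(2t + 1)^2 >= 2t]. *)
Lemma vt_far e : 0 < e -> exists M, forall u, M < `|u| -> vt u <= e.
Proof.
move=> e0; have d0 : 0 < e ^+ 2 / (2 * t).
  by rewrite divr_gt0 ?exprn_gt0// mulr_gt0.
have [M M0 hM] := probability_tight mu d0.
set A := [set x | _] in hM.
exists (M + (2 * t + 1)) => u hu; apply: vt_le => //.
have L0 : 0 < 2 * t + 1 by rewrite addr_gt0// mulr_gt0.
have AE : A = ~` `[- M, M].
  apply/seteqP; split => x; rewrite /A /= in_itv /= -ler_norml ltNge; by move/negP.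
have mA : measurable A by rewrite AE; exact: measurableC.
have iA : L1 \1_A.
  apply: integrable_indic => //; rewrite (le_lt_trans (probability_le1 _ _)) ?ltry.
have EA : E \1_A = fine (mu A) by rewrite /Rintegral integral_indic// setIT.
apply: (@le_trans _ _ (E (fun x => e ^- 2 * \1_A x + (2 * t + 1) ^- 2))).
  apply: mean_le => [||x].
  - by apply: L1_kern; rewrite gt_eqF.
  - by apply: L1D; [exact: L1Zl|exact: L1_cst].
  rewrite indicE; have [xA|xA] := boolP (x \in A).
    rewrite mulr1; apply: le_trans (kern_le_sqr _ _) _ => /=; first by rewrite gt_eqF.
    by rewrite lerDl invr_ge0 exprn_ge0// ltW.
  rewrite mulr0 add0r; have {}xA : `|x| <= M.
    by rewrite leNgt; apply/negP => h; move/negP: xA; apply; rewrite inE.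
  have hux : 2 * t + 1 <= `|u - x|.
    by have := ler_normD (u - x) x; rewrite subrK; lra.
  rewrite lef_pV2 ?posrE ?exprn_gt0//=; last first.
    by rewrite ltr_wpDl ?sqr_ge0 ?exprn_gt0.
  rewrite -[leLHS]addr0 lerD ?sqr_ge0// -(real_normK (num_real (u - x))).
  by rewrite ler_pXn2r// nnegrE ltW.
rewrite meanD ?mean_cst ?meanZl//; [|exact: L1Zl|exact: L1_cst].
rewrite EA; have h1 : e ^- 2 * fine (mu A) <= (2 * t)^-1.
  by rewrite ler_pdivrMl ?exprn_gt0.
have h2 : (2 * t + 1) ^- 2 <= (2 * t)^-1.
  have tp : 0 < 2 * t by rewrite mulr_gt0.
  rewrite lef_pV2 ?posrE ?exprn_gt0//.
  by have := sqr_ge0 (2 * t); lra.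
apply: le_trans (lerD h1 h2) _.
rewrite (_ : _ + _ = t^-1)//; field; exact: lt0r_neq0.
Qed.

Hypothesis Hnd :
  ~ (exists a : R, forall A : set R, measurable A -> mu A = \d_a A).
Variable finv : R -> R.
Hypothesis finvK : cancel finv f.
Local Notation phi := (fun u : R => 2 * vt (finv u)).

Lemma ftK : cancel f finv.
Proof.
move=> u; have := finvK (f u).
have [lt_|lt_|//] := ltgtP (finv (f u)) u => e.
  by have := ft_increasing Hnd t0 lt_; rewrite e ltxx.
by have := ft_increasing Hnd t0 lt_; rewrite e ltxx.
Qed.

(** As [f] moves points by at most [t + 1], [finv x] is far out when [x] is, and [vt_far] applies.
    The general filter covers both infinities. *)
Lemma phi_cvg0 (F : set_system R) : Filter F ->
  (forall M, \forall x \near F, M < `|x|) -> phi x @[x --> F] --> 0.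
Proof.
move=> FF hF; apply/cvgrPdist_le => e e0.
have e20 : 0 < e / 2 by rewrite divr_gt0.
have [M hM] := vt_far e20.
apply: filterS (hF (M + (t + 1))) => x hx.
have h : vt (finv x) <= e / 2.
  apply: hM; have := @Hmt_re_bound _ mu t t0 (finv x, vt (finv x)) (lexx _).
  rewrite (Hmt_graph mu t0) finvK /=.
  by have := ler_normD (x - finv x) (finv x); rewrite subrK; lra.
rewrite sub0r normrN ger0_norm; first by lra.
by rewrite mulr_ge0// vt_ge0.
Qed.

Lemma Hmt_above : H @` [set p | vt p.1 < p.2] = [set p | phi p.1 < p.2].
Proof.
apply/seteqP; split => [_ [p /= pE <-]|[x y] /= xy].
  case Hp : (H p) => [x y] /=; rewrite ltNge; apply/negP => hle.
  (* The point on or below the graph of [v_t] that the lower formula of [Hext] sends to [H p].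
     Injectivity, or the strict contraction across the graph, excludes it. *)
  pose q := (finv x, y / 2).
  have qE : q.2 <= vt q.1 by rewrite /= ler_pdivrMr// mulrC.
  have Hq : Hext mu t q = H p.
    by rewrite (Hext_hypo t0)// /q /= finvK mulrC divfK// Hp.
  move: qE; rewrite le_eqVlt => /predU1P[qE|qE].
    have qe : vt q.1 <= q.2 by rewrite qE.
    have pq : p = q.
      by apply: (Hmt_inj Hnd t0 (ltW pE) qe); rewrite -Hq Hext_epi.
    by move: pE; rewrite pq qE ltxx.
  have := Hext_contract_across Hnd t0 pE qE.
  rewrite Hq (Hext_epi (ltW pE)); move: (H p) => a.
  by rewrite !subrr !subr0 ltxx.
have y0 : 0 < y.
  by apply: le_lt_trans xy; rewrite mulr_ge0// vt_ge0.
have [p Hp] := Hext_surj Hnd t0 x y0.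
(* A preimage on or below the graph would be sent to [(f u, 2 v)] with [2 v <= phi (f u)], against
   the choice of [(x, y)]. *)
have [pE|pE] := ltP (vt p.1) p.2.
  by exists p => //; rewrite -Hp Hext_epi// ltW.
move: Hp; rewrite (Hext_hypo t0 pE) => -[px py].
by move: xy; rewrite -px ftK -py ltr_pM2l// ltNge pE.
Qed.

Lemma Hmt_graph_image :
  [set H (u, vt u) | u in setT] = [set (u, phi u) | u in setT].
Proof.
apply/seteqP; split => _ [u _ <-].
  by exists (f u) => //; rewrite ftK Hmt_graph.
by exists (finv u) => //; rewrite Hmt_graph// finvK.
Qed.

Lemma Hmt_epi_image p : vt p.1 <= p.2 -> phi (H p).1 <= (H p).2.
Proof.
rewrite le_eqVlt => /predU1P[e|pE].
  by rewrite [p]surjective_pairing -e Hmt_graph//= ftK.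
have : [set q | phi q.1 < q.2] (H p) by rewrite -Hmt_above; exists p.
by move/ltW.
Qed.

Lemma Hmt_epi_surj x y : phi x <= y ->
  exists p, vt p.1 <= p.2 /\ H p = (x, y).
Proof.
rewrite le_eqVlt => /predU1P[<-|xy].
  by exists (finv x, vt (finv x)); split => //; rewrite Hmt_graph// finvK.
have : [set q | phi q.1 < q.2] (x, y) by [].
by rewrite -Hmt_above => -[p /= /ltW pE Hp]; exists p.
Qed.

(** The complement of [Lambdat] is the closed region above the graph together with its reflection in
    the real axis, and [H] commutes with conjugation; the image of the upper piece is already
    known. *)
Lemma Hmt_compl_Lambdat :
  ~` (H @` ~` Lambdat mu t) = [set p | `|p.2| < phi p.1].
Proof.
rewrite -[RHS]setCK; congr (~` _).
apply/seteqP; split => [_ [[u v] uv <-]|[x y] /= xy].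
  have {}uv : vt u <= `|v| by rewrite leNgt; apply/negP.
  suff : phi (H (u, v)).1 <= `|(H (u, v)).2| by rewrite leNgt => /negP.
  have [v0|v0] := leP 0 v.
    move: uv; rewrite ger0_norm// => uv.
    exact: le_trans (@Hmt_epi_image (u, v) uv) (ler_norm _).
  move: uv; rewrite ltr0_norm// => uv.
  have -> : H (u, v) = ((H (u, - v)).1, - (H (u, - v)).2).
    by rewrite -(@Hmt_conj _ mu t t0 (u, - v) uv) opprK.
  have := @Hmt_epi_image (u, - v) uv; move: (H (u, - v)) => a ha /=.
  by rewrite normrN; exact: le_trans ha (ler_norm _).
move/negP: xy; rewrite -leNgt => xy.
have [p [pE Hp]] := Hmt_epi_surj xy.
have p0 : 0 <= p.2 by exact: le_trans (vt_ge0 mu t0 _) pE.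
have [y0|y0] := leP 0 y.
  exists p; last by rewrite Hp ger0_norm.
  by apply/negP; rewrite -leNgt ger0_norm.
exists (p.1, - p.2); last by rewrite Hmt_conj// Hp ltr0_norm//= opprK.
by apply/negP; rewrite -leNgt /= normrN ger0_norm.
Qed.

End Image.

Theorem theorem4p1 (R : realType) (mu : probability R R) (t : R)
  (Hndirac : ~ (exists a : R, forall A : set R, measurable A -> mu A = \d_a A))
  (Hlog : (\int[mu]_(x in `[1%R, +oo[) (ln x)%:E < +oo)%E)
  (Ht : 0 < t) :
  (* (1) *)
  ({within closure (Gammat mu t), continuous (Hmt mu t)} /\
   {in closure (Gammat mu t) &, injective (Hmt mu t)}) /\
  (* (2) *)
  (forall u0 : R, 0 < vt mu t u0 ->
     exists d : R, is_derive u0 1 (ft mu t) d /\ 0 < d < 2) /\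
  (* (3) *)
  (continuous (ft mu t) /\ {homo ft mu t : x y / x < y} /\
   (forall y : R, exists x : R, ft mu t x = y)) /\
  (* (4), (5), (6), with phi_t(u) = 2 v_t(f_t^{-1}(u)) *)
  (forall finv : R -> R, cancel finv (ft mu t) ->
   let phi := fun u : R => 2 * vt mu t (finv u) in
   (phi x @[x --> +oo] --> 0) /\ (phi x @[x --> -oo] --> 0) /\
   [set Hmt mu t (u, vt mu t u) | u in setT] = [set (u, phi u) | u in setT] /\
   Hmt mu t @` [set p | vt mu t p.1 < p.2] = [set p | phi p.1 < p.2] /\
   ~` (Hmt mu t @` ~` Lambdat mu t) = [set p | `|p.2| < phi p.1]).
Proof.
have sub := closure_Gammat Ht Hndirac.
refine (conj (conj _ _) (conj _ (conj (conj _ (conj _ _)) _))).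

- exact: Hmt_continuous sub.
- by move=> p q /set_mem/sub pE /set_mem/sub qE; exact: Hmt_inj.
- by move=> u0; exact: ft_derive.
- exact: (ft_continuous Hndirac Ht).
- exact: (ft_increasing Hndirac Ht).
- exact: (ft_surj Hndirac Ht).
- move=> finv finvK phi.
  refine (conj _ (conj _ (conj _ (conj _ _)))).
  + have FF : Filter (pinfty_nbhs R) by typeclasses eauto.
    apply: (phi_cvg0 Ht finvK FF) => M.
    have := nbhs_pinfty_gt (num_real M); apply: filterS => x Mx.
    exact: lt_le_trans Mx (ler_norm x).
  + have FF : Filter (ninfty_nbhs R) by typeclasses eauto.
    apply: (phi_cvg0 Ht finvK FF) => M.
    have := nbhs_ninfty_lt (num_real (- M)); apply: filterS => x xM.
    by rewrite -normrN; apply: lt_le_trans (ler_norm _); rewrite ltrNr.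
  + exact: Hmt_graph_image.
  + exact: Hmt_above.
  + exact: Hmt_compl_Lambdat.
Qed.
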